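(* Let $\mathbb{F}$ be algebraically closed (of characteristic not $2$ or $3$). 1. Let $\mathcal{A}^c_{3g}=\{m\in\mathcal{A}^c_3:\nu(m)\notin\Gamma_{\mathrm{Cardano}}\}$. The map $\hat\nu_s:\mathcal{A}^c_{3g}/SL(V)\to\big(\mathbb{F}^2\setminus\Gamma_{\mathrm{Cardano}}\big)\times\big(L\setminus\{0\}\big)$ given by $$\hat\nu_s(m)=\Big(\nu(m),\frac{\mathrm{Inv}_m}{\mathrm{Disc}(Q_m)}\Big)$$ is a bijection. 2. Let $\mathcal{A}^c_{3C}=\{m\in\mathcal{A}^c_3:\nu(m)\in\Gamma_{\mathrm{Cardano}}\setminus\{(0,0)\}\}$. The map $\hat{\hat\nu}_s:\mathcal{A}^c_{3C}/SL(V)\to\big(\Gamma_{\mathrm{Cardano}}\setminus\{(0,0)\}\big)\times\big(L^2\setminus\{0\}\big)$ given by $\hat{\hat\nu}_s(m)=(\nu(m),\mathrm{Disc}(Q_m))$ is a bijection. 3. Let $\mathcal{A}^c_{30}=\{m\in\mathcal{A}^c_3:\nu(m)=(0,0)\}$. The map $\hat\nu_0:\mathcal{A}^c_{30}/SL(V)\to L^2\setminus\{0\}$ given by $\hat\nu_0(m)=\mathrm{Disc}(Q_m)$ is a bijection.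
   Context: $V$ is a two-dimensional $\mathbb{F}$-vector space. $L=\Lambda^2(V^* )$ is the one-dimensional space of antisymmetric bilinear forms on $V$, $L^{-1}$ its dual, $L^r$ the $r$-th tensor power, with $L^r\otimes L^s=L^{r+s}$ (so the quotient of an element of $L^3$ by a nonzero element of $L^2$ lies in $L$). $\mathcal{A}^c$ is the set of symmetric bilinear maps $m:V\times V\to V$. $GL(V)$, and hence $SL(V)$, acts on $\mathcal{A}^c$ by $(g\cdot m)(v,w)=g\big(m(g^{-1}v,g^{-1}w)\big)$. Let $(e_1,e_2)$ be a basis of $V$ with dual basis $(\epsilon_1,\epsilon_2)$, put $\omega=\epsilon_1\wedge\epsilon_2$, and write $m(e_1,e_1)=ae_1+be_2$, $m(e_2,e_2)=ce_1+de_2$, $m(e_1,e_2)=ee_1+fe_2$. The fundamental cubic is $Q_m(v)=m(v,v)\wedge v$; thus $Q_m(xe_1+ye_2)=q(x,y)\,e_1\wedge e_2$ with $q(x,y)=-bx^3+(a-2f)x^2y+(2e-d)xy^2+cy^3$. Writing $q=Ax^3+Bx^2y+Cxy^2+Dy^3$, $\mathrm{Disc}(Q_m)=(18ABCD+B^2C^2-4AC^3-4B^3D-27A^2D^2)\,\omega^2\in L^2$. Put $\mu(x,y)=q_{xx}q_{yy}-q_{xy}^2$, $G(x,y)=q_x\mu_y-q_y\mu_x$, $\tau=(d+e,-(a+f))$. Define $\tilde p_3(m)=-8q(\tau)\omega^2\in L^2$, $\tilde p_2(m)=\mu(\tau)\omega^2\in L^2$, $\mathrm{Inv}_m=\frac1{54}G(\tau)\omega^3\in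 L^3$. These do not depend on the basis and are invariant under $SL(V)$. $\mathcal{A}^c_3=\{m\in\mathcal{A}^c:\mathrm{Disc}(Q_m)\ne0\}$; for $m\in\mathcal{A}^c_3$, $\nu(m)=(p_3(m),p_2(m))\in\mathbb{F}^2$ with $p_i(m)=\tilde p_i(m)/\mathrm{Disc}(Q_m)$. $\Gamma_{\mathrm{Cardano}}=\{(p_3,p_2)\in\mathbb{F}^2:27p_3^2+4p_2^3=0\}$. The maps are written on representatives of $SL(V)$-classes. *)

(* Defs.v *)
From HB Require Import structures.
From mathcomp Require Import all_boot all_order all_algebra.
From mathcomp Require Import mpoly ring.

Set Implicit Arguments.
Unset Strict Implicit.
Unset Printing Implicit Defensive.

Import GRing.Theory.
Local Open Scope ring_scope.

Fact linfun_linE (F : fieldType) (V W : vectType F) (f : V -> W) :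
  linear f -> linfun f =1 f.
Proof.
move=> lin_f v; pose g := HB.pack f
  (GRing.isLinear.Build F V W _ f lin_f) : {linear V -> W}.
exact: (lfunE g v).
Qed.

Fact lin_scale (F : fieldType) (V W : vectType F) (f : V -> W) k v :
  linear f -> f (k *: v) = k *: f v.
Proof. by move=> lin_f; rewrite -!(linfun_linE lin_f) linearZ. Qed.

Section Bilinear.
Variables (F : fieldType) (V W : vectType F).
Implicit Type f : 'Hom(V, 'Hom(V, W)).

(* [linfun f] agrees with f only when f is linear; similarly for [bilfun],
   see [bilfunE]. *)
Definition bilfun (b : V -> V -> W) : 'Hom(V, 'Hom(V, W)) :=
  linfun (fun v => linfun (b v)).

Lemma bilfunE (b : V -> V -> W) :
  (forall v, linear (b v)) -> (forall w, linear (b^~ w)) ->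
  forall v w, bilfun b v w = b v w.
Proof.
move=> linr linl v w; rewrite /bilfun linfun_linE; first exact: linfun_linE.
move=> k x y; apply/lfunP=> u.
by rewrite linfun_linE // lfunE /= lfunE /= !linfun_linE // linl.
Qed.

Definition flip f : 'Hom(V, 'Hom(V, W)) := bilfun (fun v w => f w v).

Lemma flipE f v w : flip f v w = f w v.
Proof.
apply: (bilfunE (b := fun v w => f w v)) => [x k y z|x k y z] /=.
  by rewrite linearP lfunE /= lfunE.
by rewrite linearP.
Qed.

Fact flip_is_linear : linear flip.
Proof.
move=> k f g; apply/lfunP=> v; apply/lfunP=> w.
rewrite flipE lfunE /= lfunE /= !lfunE /= !lfunE /=.
by rewrite !flipE.
Qed.

Definition symbil : {vspace 'Hom(V, 'Hom(V, W))} := lker (linfun (fun f => f - flip f)).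
Definition antibil : {vspace 'Hom(V, 'Hom(V, W))} := lker (linfun (fun f => f + flip f)).

Lemma symbilP f : reflect (forall v w, f v w = f w v) (f \in symbil).
Proof.
rewrite memv_ker linfun_linE => [|k g h]; last first.
  by rewrite flip_is_linear scalerBr opprD addrACA.
rewrite subr_eq0; apply: (iffP eqP) => [fE v w|fE].
  by rewrite {1}fE flipE.
by apply/lfunP=> v; apply/lfunP=> w; rewrite flipE.
Qed.

Lemma antibilP f : reflect (forall v w, f v w = - f w v) (f \in antibil).
Proof.
rewrite memv_ker linfun_linE => [|k g h]; last first.
  by rewrite flip_is_linear scalerDr addrACA.
rewrite addr_eq0; apply: (iffP eqP) => [fE v w|fE].
  by rewrite {1}fE !opp_lfunE flipE.
by apply/lfunP=> v; apply/lfunP=> w; rewrite !opp_lfunE flipE.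
Qed.

End Bilinear.

Section Lpow.
Variables (F : fieldType) (V : vectType F).

(* [Lpow V r] is the r-th tensor power of L = Lambda^2(V^* ).  As L (x) W is
   the space of antisymmetric bilinear maps V x V -> W, the tensor powers are
   obtained by iteration: an element of [Lpow V r] is a 2r-linear form,
   antisymmetric in each of r consecutive pairs of arguments.  [Lpow V 0] is
   the field, and [Lpow V 1] is the space of antisymmetric bilinear forms. *)
Fixpoint Lpow (r : nat) : vectType F :=
  if r is r'.+1 then subvs_of (antibil V (Lpow r')) else F^o.

Definition Lval r (x : Lpow r.+1) : 'Hom(V, 'Hom(V, Lpow r)) := vsval x.

Definition Lmk r (f : 'Hom(V, 'Hom(V, Lpow r))) : Lpow r.+1 :=
  vsproj (antibil V (Lpow r)) f.

Lemma LvalMk r (f : 'Hom(V, 'Hom(V, Lpow r))) :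
  f \in antibil V (Lpow r) -> Lval (Lmk f) = f.
Proof. exact: vsprojK. Qed.

Lemma Lval_anti r (x : Lpow r.+1) v w : Lval x v w = - Lval x w v.
Proof. by apply/antibilP; exact: (subvsP x). Qed.

Lemma Lval_inj r : injective (@Lval r).
Proof. exact: val_inj. Qed.

Lemma Lval_linear r : linear (@Lval r).
Proof. by []. Qed.

(* The tensor product L^r (x) L^s -> L^(r+s):
   (x (x) y)(v, w) = x(v, w) (x) y. *)
Fixpoint Lmul (r s : nat) : Lpow r -> Lpow s -> Lpow (r + s) :=
  match r return Lpow r -> Lpow s -> Lpow (r + s) with
  | 0 => fun x y => (x : F) *: y
  | r'.+1 => fun x y =>
      Lmk (bilfun (fun v w => Lmul (Lval x v w) y))
  end.

Fact LmulS r s (x : Lpow r.+1) (y : Lpow s) v w :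
  linear (fun z : Lpow r => Lmul z y) ->
  Lval (Lmul x y : Lpow (r + s).+1) v w = Lmul (Lval x v w) y.
Proof.
move=> linl.
have E v' w' : bilfun (fun v w => Lmul (Lval x v w) y) v' w'
    = Lmul (Lval x v' w') y.
  apply: (bilfunE (b := fun v w => Lmul (Lval x v w) y)) => [u k a b|u k a b].
    by rewrite linearP linl.
  by rewrite linearP !lfunE /= !lfunE linl.
rewrite /= LvalMk ?E //; apply/antibilP=> a b; rewrite !E Lval_anti.
by rewrite -!(linfun_linE linl) linearN.
Qed.

Lemma Lmul_linl r s (y : Lpow s) : linear (fun x : Lpow r => Lmul x y).
Proof.
elim: r => [|r linl] k x1 x2; first by rewrite /= scalerDl scalerA.
apply: Lval_inj; apply/lfunP=> v; apply/lfunP=> w.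
rewrite (Lval_linear k (Lmul x1 y : Lpow (r + s).+1) (Lmul x2 y)).
rewrite !(add_lfunE, scale_lfunE) !LmulS // Lval_linear.
by rewrite !(add_lfunE, scale_lfunE) linl.
Qed.

Lemma LmulE r s (x : Lpow r.+1) (y : Lpow s) v w :
  Lval (Lmul x y : Lpow (r + s).+1) v w = Lmul (Lval x v w) y.
Proof. exact/LmulS/Lmul_linl. Qed.

Lemma Lmul_linr r s (x : Lpow r) : linear (fun y : Lpow s => Lmul x y).
Proof.
elim: r x => [|r linr] x k y1 y2; first by rewrite /= scalerDr !scalerA mulrC.
apply: Lval_inj; apply/lfunP=> v; apply/lfunP=> w.
rewrite (Lval_linear k (Lmul x y1 : Lpow (r + s).+1) (Lmul x y2)).
by rewrite !(add_lfunE, scale_lfunE) !LmulE linr.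
Qed.

Fixpoint Lexp (x : Lpow 1) (r : nat) : Lpow r :=
  match r return Lpow r with
  | 0 => (1 : F)
  | r'.+1 => @Lmul 1 r' x (Lexp x r')
  end.

(* For dim V = 2 and y != 0, the map z |-> z (x) y is bijective and
   [Ldiv x y] is the z such that z (x) y = x; see [LdivK] and [LmulK] below. *)
Definition Ldiv (r s : nat) (x : Lpow (r + s)) (y : Lpow s) : Lpow r :=
  ((linfun (fun z : Lpow r => Lmul z y))^-1)%VF x.

End Lpow.

Arguments Lmul {F V r s} x y.
Arguments Lexp {F V} x r.
Arguments Ldiv {F V} r s x y.

Section Invariants.
Variables (F : fieldType) (V : vectType F).

Local Notation bilmap := 'Hom(V, 'Hom(V, V)).

Definition SL (g : 'End(V)) : bool :=
  \det (passmx.mxof (vbasis {:V}) (vbasis {:V}) g) == 1.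

Definition gact (g : 'End(V)) (m : bilmap) : bilmap :=
  bilfun (fun v w => g (m ((g^-1)%VF v) ((g^-1)%VF w))).

Lemma gactE g m v w :
  gact g m v w = g (m ((g^-1)%VF v) ((g^-1)%VF w)).
Proof.
rewrite /gact bilfunE // => [x k y z|x k y z] /=; first by rewrite !linearP.
by rewrite linearP linearP !lfunE /= !lfunE /= linearP.
Qed.

Section Basis.
Variable e : 2.-tuple V.

Definition omega_bil : 'Hom(V, 'Hom(V, F^o)) :=
  bilfun (fun v w =>
    coord e 0 v * coord e 1 w - coord e 1 v * coord e 0 w : F^o).

Lemma omega_bilE v w : omega_bil v w =
  coord e 0 v * coord e 1 w - coord e 1 v * coord e 0 w.
Proof.
have scaleE (k x : F) : k *: (x : F^o) = k * x by [].
by rewrite /omega_bil bilfunE // => [x k y z|x k y z];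
  rewrite !linearP /= !scaleE; ring.
Qed.

Definition omega : Lpow V 1 := @Lmk F V 0 omega_bil.

Lemma omegaE v w : Lval omega v w =
  coord e 0 v * coord e 1 w - coord e 1 v * coord e 0 w.
Proof.
rewrite /omega LvalMk ?omega_bilE //; apply/antibilP=> x y.
by rewrite !omega_bilE; ring.
Qed.

Lemma Lexp_omegaS r v w :
  Lval (Lexp omega r.+1) v w = Lval omega v w *: Lexp omega r.
Proof. exact: (@LmulE F V 0 r omega (Lexp omega r)). Qed.

Section BasisTheory.
Hypothesis e_basis : basis_of {:V} e.

Lemma coord_e (i j : 'I_2) : coord e i e`_j = (i == j :> nat)%:R.
Proof. by rewrite coord_free ?(basis_free e_basis) // eq_sym. Qed.

Lemma e_span v : v = coord e 0 v *: e`_0 + coord e 1 v *: e`_1.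
Proof.
rewrite {1}(coord_basis e_basis (memvf v)) big_ord_recl big_ord1.
by congr (_ *: _ + coord e _ v *: _); apply: val_inj.
Qed.

Lemma omega_e : Lval omega e`_0 e`_1 = 1.
Proof. rewrite omegaE (coord_e 0 0) (coord_e 0 1) (coord_e 1 0) (coord_e 1 1) /=.
by rewrite mulr0 subr0 mulr1. Qed.

Hypothesis char_neq2 : 2%N \notin [pchar F].

Lemma Lval_diag r (x : Lpow V r.+1) v : Lval x v v = 0.
Proof.
have nz2 : 2%:R != 0 :> F by apply: contra char_neq2; rewrite inE.
apply/eqP; rewrite -(inj_eq (scalerI nz2)) scaler0 scaler_nat mulr2n.
by rewrite {1}Lval_anti addNr.
Qed.

Lemma LvalE r (x : Lpow V r.+1) v w :
  Lval x v w = (Lval omega v w : F) *: Lval x e`_0 e`_1.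
Proof.
rewrite {1}(e_span v) {1}(e_span w) !(linearD, linearZ) /=.
rewrite !(add_lfunE, scale_lfunE) !(linearD, linearZ) /= !Lval_diag.
rewrite [Lval x e`_1 e`_0]Lval_anti !scaler0 add0r addr0 scalerN scalerN.
by rewrite !scalerA addrC -scalerBl omegaE.
Qed.

Lemma Lpow_omega r (x : Lpow V r) : exists k : F, x = k *: Lexp omega r.
Proof.
elim: r x => [|r IHr] x; first by exists x; rewrite /= [RHS]mulr1.
have [k Dk] := IHr (Lval x e`_0 e`_1); exists k.
apply: Lval_inj; apply/lfunP=> v; apply/lfunP=> w.
rewrite LvalE Dk (lin_scale _ _ (@Lval_linear F V r)) !scale_lfunE Lexp_omegaS.
by rewrite !scalerA mulrC.
Qed.

Lemma Lexp_omega_neq0 r : Lexp omega r != 0.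
Proof.
elim: r => [|r]; first exact: oner_neq0.
apply: contra => /eqP E; have := Lexp_omegaS r e`_0 e`_1.
by rewrite E omega_e scale1r => <-; rewrite !zero_lfunE.
Qed.

Lemma Lmul_omega r s :
  Lmul (Lexp omega r) (Lexp omega s) = Lexp omega (r + s) :> Lpow V (r + s).
Proof.
elim: r => [|r IHr]; first by rewrite /= scale1r.
apply: Lval_inj; apply/lfunP=> v; apply/lfunP=> w.
rewrite LmulE !Lexp_omegaS -IHr.
exact: (lin_scale _ _ (@Lmul_linl F V r s (Lexp omega s))).
Qed.

Lemma Lmul_inj r s (y : Lpow V s) :
  y != 0 -> injective (fun x : Lpow V r => Lmul x y).
Proof.
have [k ->] := Lpow_omega y; rewrite scaler_eq0 negb_or => /andP[nz_k _].
move=> x1 x2 /=; have [k1 ->] := Lpow_omega x1; have [k2 ->] := Lpow_omega x2.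
rewrite !(lin_scale _ _ (@Lmul_linr F V r s _)) !(lin_scale _ _ (@Lmul_linl F V r s _)).
move/(scalerI nz_k)/eqP; rewrite -subr_eq0 -scalerBl scaler_eq0 Lmul_omega.
by rewrite (negPf (Lexp_omega_neq0 _)) orbF subr_eq0 => /eqP->.
Qed.

Lemma LmulK r s (x : Lpow V r) (y : Lpow V s) :
  y != 0 -> Ldiv r s (Lmul x y) y = x.
Proof.
move=> nz_y; have linl := @Lmul_linl F V r s y.
rewrite /Ldiv -(linfun_linE linl); apply: lker0_lfunK.
by apply/lker0P=> x1 x2; rewrite !(linfun_linE linl); apply: Lmul_inj.
Qed.

Lemma LdivK r s (x : Lpow V (r + s)) (y : Lpow V s) :
  y != 0 -> Lmul (Ldiv r s x y) y = x.
Proof.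
move=> nz_y; suff [z ->] : exists z : Lpow V r, x = Lmul z y by rewrite LmulK.
move: nz_y; have [k ->] := Lpow_omega y; have [l ->] := Lpow_omega x.
rewrite scaler_eq0 negb_or => /andP[nz_k _].
exists ((l / k) *: Lexp omega r).
rewrite (lin_scale _ _ (@Lmul_linr F V r s _)) (lin_scale _ _ (@Lmul_linl F V r s _)).
by rewrite Lmul_omega scalerA mulrCA divff ?mulr1.
Qed.

End BasisTheory.

Variable m : bilmap.

Definition coef_a : F := coord e 0 (m e`_0 e`_0).
Definition coef_b : F := coord e 1 (m e`_0 e`_0).
Definition coef_c : F := coord e 0 (m e`_1 e`_1).
Definition coef_d : F := coord e 1 (m e`_1 e`_1).
Definition coef_e : F := coord e 0 (m e`_0 e`_1).
Definition coef_f : F := coord e 1 (m e`_0 e`_1).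

Definition cubA : F := - coef_b.
Definition cubB : F := coef_a - 2%:R * coef_f.
Definition cubC : F := 2%:R * coef_e - coef_d.
Definition cubD : F := coef_c.

(* The cubic q, with x = 'X_0 and y = 'X_1; see [fundamental_cubicE] for
   m(v, v) /\ v = q(x, y) e_1 /\ e_2. *)
Definition cubic : {mpoly F[2]} :=
  cubA *: 'X_0 ^+ 3 + cubB *: ('X_0 ^+ 2 * 'X_1)
  + cubC *: ('X_0 * 'X_1 ^+ 2) + cubD *: 'X_1 ^+ 3.

Lemma cubicE (x : 'I_2 -> F) : cubic.@[x] =
  cubA * x 0 ^+ 3 + cubB * (x 0 ^+ 2 * x 1)
  + cubC * (x 0 * x 1 ^+ 2) + cubD * x 1 ^+ 3.
Proof. by rewrite /cubic !(mevalD, mevalZ, mevalM, mevalXU, rmorphXn). Qed.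

Lemma fundamental_cubicE v : basis_of {:V} e -> m \in symbil V V ->
  Lval omega (m v v) v = cubic.@[fun i => coord e i v].
Proof.
move=> e_basis /symbilP m_sym; rewrite cubicE omegaE.
set x : F := coord e 0 v; set y : F := coord e 1 v.
have mE i : coord e i (m v v) = x ^+ 2 * coord e i (m e`_0 e`_0)
    + 2%:R * x * y * coord e i (m e`_0 e`_1) + y ^+ 2 * coord e i (m e`_1 e`_1).
  have comb (W : vectType F) (f : 'Hom(V, W)) :
    f v = x *: f e`_0 + y *: f e`_1.
    by rewrite {1}(e_span e_basis v) linearD !linearZ.
  have coordE u w (k l : F) :
    coord e i (k *: u + l *: w) = k * coord e i u + l * coord e i w.
    by rewrite linearD !linearZ.
  rewrite (comb _ (m v)) (comb _ m) !(add_lfunE, scale_lfunE) (m_sym e`_1 e`_0).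
  by rewrite !coordE; ring.
rewrite !mE -/coef_a -/coef_b -/coef_c -/coef_d -/coef_e -/coef_f.
by rewrite /cubA /cubB /cubC /cubD; ring.
Qed.

Definition Disc : Lpow V 2 :=
  (18%:R * cubA * cubB * cubC * cubD + cubB ^+ 2 * cubC ^+ 2
   - 4%:R * cubA * cubC ^+ 3 - 4%:R * cubB ^+ 3 * cubD
   - 27%:R * cubA ^+ 2 * cubD ^+ 2) *: Lexp omega 2.

Definition hessian : {mpoly F[2]} :=
  let q := cubic in
  q^`M(0)^`M(0) * q^`M(1)^`M(1) - q^`M(0)^`M(1) ^+ 2.

Definition covariantG : {mpoly F[2]} :=
  cubic^`M(0) * hessian^`M(1) - cubic^`M(1) * hessian^`M(0).

Definition tau : 'I_2 -> F :=
  tnth [tuple coef_d + coef_e; - (coef_a + coef_f)].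

Definition tp3 : Lpow V 2 := (- 8%:R * cubic.@[tau]) *: Lexp omega 2.
Definition tp2 : Lpow V 2 := hessian.@[tau] *: Lexp omega 2.
Definition Inv : Lpow V 3 := (54%:R^-1 * covariantG.@[tau]) *: Lexp omega 3.

Definition p3 : F := Ldiv 0 2 tp3 Disc.
Definition p2 : F := Ldiv 0 2 tp2 Disc.
Definition nu : F * F := (p3, p2).

Definition Ac3 : bool := (m \in symbil V V) && (Disc != 0).

End Basis.

Definition cardano (p : F * F) : bool :=
  27%:R * p.1 ^+ 2 + 4%:R * p.2 ^+ 3 == 0.

Definition Ac3g (e : 2.-tuple V) (m : bilmap) : bool :=
  Ac3 e m && ~~ cardano (nu e m).
Definition Ac3C (e : 2.-tuple V) (m : bilmap) : bool :=
  Ac3 e m && (cardano (nu e m) && (nu e m != (0, 0))).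
Definition Ac30 (e : 2.-tuple V) (m : bilmap) : bool :=
  Ac3 e m && (nu e m == (0, 0)).

Definition SLorbit (m : bilmap) : bilmap -> Prop :=
  fun m' => exists2 g, SL g & m' = gact g m.

(* The quotient D / SL(V), as the set of orbits of the elements of D. *)
Definition SLquotient (D : bilmap -> bool) :=
  {O : bilmap -> Prop | exists2 m, D m & O = SLorbit m}.

(* f, written on representatives, is a well-defined map from D / SL(V) to
   {y | E y}, and this map is a bijection. *)
Definition SLbijection (Y : Type) (D : bilmap -> bool) (E : Y -> bool)
    (f : bilmap -> Y) : Prop :=
  (forall g m, SL g -> D m -> D (gact g m)) /\
  exists h : SLquotient D -> {y : Y | E y},
    (forall (O : SLquotient D) m, D m -> sval O m -> sval (h O) = f m)
    /\ bijective h.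

End Invariants.

(* Main.v *)
Require Import Defs.
From HB Require Import structures.
From mathcomp Require Import all_boot all_order all_algebra.
From mathcomp Require Import mpoly ring boolp.

Set Implicit Arguments.
Unset Strict Implicit.
Unset Printing Implicit Defensive.

Import GRing.Theory.
Local Open Scope ring_scope.

(** A symmetric multiplication m splits into a trace-free part, the binary cubic
    q, and a trace, the vector tau; since 3 is invertible, the pair (q, tau)
    determines m and can be prescribed freely ([coords_inj],
    [coords_onto]).  This correspondence is SL(V)-equivariant ([coords_gact]), so
    the theorem is about SL_2-orbits of pairs (cubic, vector).

    Write D, P, H, G for the discriminant of q and for the values at tau of q, of
    its Hessian mu and of the Jacobian covariant G.  These are SL_2-invariants,
    and they satisfy the classical syzygy G^2 + H^3 + 432 P^2 D = 0 between the
    covariants of a binary cubic.  The heart of the matter is that, over an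
    algebraically closed field, the orbits with D <> 0 are exactly the points of
    this hypersurface with D <> 0 ([sl_equiv_of_invariants],
    [invariants_onto]).  Indeed the roots of the Hessian of q can be moved to 0
    and infinity, which turns q into x^3 + d y^3 with D = - 27 d^2; the sign of d
    can be chosen.  If tau = (s, t) in these coordinates, then P and G give s^3
    and d t^3 through their sum and difference, and H gives s t.  These three
    numbers fix (s, t) up to the cube roots of unity diag(z, z^-1), which
    preserve the normal form, and the only relation they satisfy,
    s^3 t^3 = (s t)^3, is the syzygy.

    In terms of p_3 = - 8 P / D and p_2 = H / D the syzygy reads
    D^3 (27 p_3^2 + 4 p_2^3) = - 4 G^2.  So nu(m) lies on the Cardano curve
    exactly when G = 0.  Off the curve, nu and G / D determine
    D = - 4 (G / D)^2 / (27 p_3^2 + 4 p_2^3), hence all four invariants, and can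
    be prescribed as long as G / D <> 0.  On the curve G = 0, and nu and D are
    free coordinates; at the origin only D is left. *)

(** * Binary cubics with a vector *)

Section Coordinates.
Variable R : comNzRingType.

(** The cubic A x^3 + B x^2 y + C x y^2 + D y^3 together with the vector
    (s, t). *)
Record cubvec := CubVec { xA : R; xB : R; xC : R; xD : R; xs : R; xt : R }.
Implicit Type x y : cubvec.

Definition cub x (u v : R) :=
  xA x * u ^+ 3 + xB x * (u ^+ 2 * v) + xC x * (u * v ^+ 2) + xD x * v ^+ 3.

(** The Hessian determinant is
    [hessA] x^2 + [hessB] x y + [hessC] y^2. *)
Definition hessA x := 4%:R * (3%:R * xA x * xC x - xB x ^+ 2).
Definition hessB x := 4%:R * (9%:R * xA x * xD x - xB x * xC x).
Definition hessC x := 4%:R * (3%:R * xB x * xD x - xC x ^+ 2).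

Definition invD x :=
  18%:R * xA x * xB x * xC x * xD x + xB x ^+ 2 * xC x ^+ 2
   - 4%:R * xA x * xC x ^+ 3 - 4%:R * xB x ^+ 3 * xD x
   - 27%:R * xA x ^+ 2 * xD x ^+ 2.
Definition invP x := cub x (xs x) (xt x).
Definition invH x :=
  hessA x * xs x ^+ 2 + hessB x * (xs x * xt x) + hessC x * xt x ^+ 2.
(** The Jacobian q_x mu_y - q_y mu_x of the cubic q and its Hessian mu, at the
    vector (s, t). *)
Definition invG x :=
  (3%:R * xA x * xs x ^+ 2 + 2%:R * xB x * (xs x * xt x) + xC x * xt x ^+ 2)
    * (hessB x * xs x + 2%:R * hessC x * xt x)
  - (xB x * xs x ^+ 2 + 2%:R * xC x * (xs x * xt x) + 3%:R * xD x * xt x ^+ 2)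
    * (2%:R * hessA x * xs x + hessB x * xt x).

Definition invariants x := (invD x, invP x, invH x, invG x).

Lemma eq_invariants x y : invariants x = invariants y ->
  [/\ invD x = invD y, invP x = invP y, invH x = invH y & invG x = invG y].
Proof. by case. Qed.

(** With M the matrix of rows (a, b) and (c, d), the cubic is composed with M
    and the vector is multiplied by the adjugate of M, which is the inverse of M
    when the determinant is 1.  The adjugate keeps every weight a polynomial
    identity in a, b, c, d. *)
Definition pullback (a b c d : R) x : cubvec := CubVec
  (cub x a c)
  (3%:R * xA x * a ^+ 2 * b + xB x * (a ^+ 2 * d + 2%:R * a * b * c)
   + xC x * (2%:R * a * c * d + b * c ^+ 2) + 3%:R * xD x * c ^+ 2 * d)
  (3%:R * xA x * a * b ^+ 2 + xB x * (b ^+ 2 * c + 2%:R * a * b * d)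
   + xC x * (2%:R * b * c * d + a * d ^+ 2) + 3%:R * xD x * c * d ^+ 2)
  (cub x b d)
  (d * xs x - b * xt x) (a * xt x - c * xs x).

Lemma invD_pullback a b c d x :
  invD (pullback a b c d x) = (a * d - b * c) ^+ 6 * invD x.
Proof. by rewrite /invD /pullback /cub /=; ring. Qed.

Lemma invP_pullback a b c d x :
  invP (pullback a b c d x) = (a * d - b * c) ^+ 3 * invP x.
Proof. by rewrite /invP /pullback /cub /=; ring. Qed.

Lemma invH_pullback a b c d x :
  invH (pullback a b c d x) = (a * d - b * c) ^+ 4 * invH x.
Proof. by rewrite /invH /hessA /hessB /hessC /pullback /cub /=; ring. Qed.

Lemma invG_pullback a b c d x :
  invG (pullback a b c d x) = (a * d - b * c) ^+ 6 * invG x.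
Proof. by rewrite /invG /hessA /hessB /hessC /pullback /cub /=; ring. Qed.

(** The classical relation between a binary cubic, its discriminant and its
    two covariants; it is the only relation between the four invariants. *)
Lemma syzygy x : invG x ^+ 2 + invH x ^+ 3 + 432%:R * invP x ^+ 2 * invD x = 0.
Proof. by rewrite /invG /invH /invP /invD /hessA /hessB /hessC /cub /=; ring. Qed.

Lemma pullback1 x : pullback 1 0 0 1 x = x.
Proof. by case: x => A B C D s t; rewrite /pullback /cub /=; f_equal; ring. Qed.

Lemma pullback_comp a b c d a' b' c' d' x :
  pullback a' b' c' d' (pullback a b c d x) =
  pullback (a * a' + b * c') (a * b' + b * d') (c * a' + d * c')
    (c * b' + d * d') x.
Proof. by rewrite /pullback /cub /=; f_equal; ring. Qed.

Definition sl_equiv x y :=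
  exists a b c d, a * d - b * c = 1 /\ y = pullback a b c d x.

Lemma sl_equiv_trans y x z : sl_equiv x y -> sl_equiv y z -> sl_equiv x z.
Proof.
move=> [a [b [c [d [det1 ->]]]]] [a' [b' [c' [d' [det1' ->]]]]].
rewrite pullback_comp; do 4!eexists; split; last reflexivity.
transitivity ((a * d - b * c) * (a' * d' - b' * c')); first by ring.
by rewrite det1 det1' mulr1.
Qed.

Lemma sl_equiv_sym x y : sl_equiv x y -> sl_equiv y x.
Proof.
move=> [a [b [c [d [det1 ->]]]]]; exists d, (- b), (- c), a; split.
  by rewrite -det1; ring.
rewrite pullback_comp -[LHS]pullback1; congr (pullback _ _ _ _ x);
  rewrite -?det1; ring.
Qed.

Lemma sl_equiv_invariants x y : sl_equiv x y -> invariants x = invariants y.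
Proof.
move=> [a [b [c [d [det1 ->]]]]]; rewrite /invariants.
rewrite invD_pullback invP_pullback invH_pullback invG_pullback.
by rewrite det1 !expr1n !mul1r.
Qed.

Lemma hessA_pullback a b c d x : hessA (pullback a b c d x) =
  (a * d - b * c) ^+ 2
  * (hessA x * a ^+ 2 + hessB x * (a * c) + hessC x * c ^+ 2).
Proof. by rewrite /hessA /hessB /hessC /pullback /cub /=; ring. Qed.

Lemma hessC_pullback a b c d x : hessC (pullback a b c d x) =
  (a * d - b * c) ^+ 2
  * (hessA x * b ^+ 2 + hessB x * (b * d) + hessC x * d ^+ 2).
Proof. by rewrite /hessA /hessB /hessC /pullback /cub /=; ring. Qed.

(** A cubic with distinct roots has a Hessian with distinct roots; these two
    roots are the points that the normal form sends to 0 and infinity. *)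
Lemma hess_disc x : hessB x ^+ 2 - 4%:R * hessA x * hessC x = - 48%:R * invD x.
Proof. by rewrite /hessA /hessB /hessC /invD; ring. Qed.

Definition diag_form d s t : cubvec := CubVec 1 0 0 d s t.

Lemma invD_diag d s t : invD (diag_form d s t) = - 27%:R * d ^+ 2.
Proof. by rewrite /invD /=; ring. Qed.

Lemma invP_diag d s t : invP (diag_form d s t) = s ^+ 3 + d * t ^+ 3.
Proof. by rewrite /invP /cub /=; ring. Qed.

Lemma invH_diag d s t : invH (diag_form d s t) = 36%:R * d * (s * t).
Proof. by rewrite /invH /hessA /hessB /hessC /=; ring. Qed.

Lemma invG_diag d s t :
  invG (diag_form d s t) = 108%:R * d * (s ^+ 3 - d * t ^+ 3).
Proof. by rewrite /invG /hessA /hessB /hessC /=; ring. Qed.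

End Coordinates.

(** * Orbits over an algebraically closed field *)

Lemma nat23_neq0 (F : fieldType) i j :
  2%N \notin [pchar F] -> 3%N \notin [pchar F] -> (2 ^ i * 3 ^ j)%:R != 0 :> F.
Proof.
move=> char_neq2 char_neq3.
have nz2 : 2%:R != 0 :> F by apply: contra char_neq2; rewrite inE.
have nz3 : 3%:R != 0 :> F by apply: contra char_neq3; rewrite inE.
by rewrite natrM !natrX mulf_neq0 // expf_neq0.
Qed.

Section ClosedField.
Variable F : closedFieldType.
Implicit Type x y : cubvec F.
Hypothesis char_neq2 : 2%N \notin [pchar F].
Hypothesis char_neq3 : 3%N \notin [pchar F].

Let nz2 : 2%:R != 0 :> F := nat23_neq0 1 0 char_neq2 char_neq3.
Let nz3 : 3%:R != 0 :> F := nat23_neq0 0 1 char_neq2 char_neq3.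

Lemma root_exists n (a : F) : (0 < n)%N -> exists r, r ^+ n = a.
Proof.
move=> n_gt0; have [r Dr] := solve_monicpoly (fun i => a *+ (i == 0%N)) n_gt0.
exists r; rewrite Dr; case: n n_gt0 {Dr} => // n _.
by rewrite big_ord_recl big1 => [|i _]; rewrite /= ?mul0r // addr0 mulr1.
Qed.

Lemma cube_eq0 (r : F) : (r ^+ 3 == 0) = (r == 0).
Proof. by rewrite expf_eq0. Qed.

Lemma quadratic_root (p q r : F) :
  exists u v, (u != 0) || (v != 0) /\ p * u ^+ 2 + q * (u * v) + r * v ^+ 2 = 0.
Proof.
have [-> | nz_p] := eqVneq p 0.
  by exists 1, 0; rewrite oner_eq0; split=> //; ring.
have [u Du] := solve_monicpoly (fun i => - nth 0 [:: r; q] i / p) (isT : 0 < 2)%N.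
exists u, 1; rewrite oner_eq0 orbT; split=> //.
by rewrite Du big_ord_recl big_ord1 /=; field.
Qed.

(** A root of the Hessian is completed to a unimodular basis in which it is the
    first vector. *)
Lemma hessA_root x : exists2 y, sl_equiv x y & hessA y = 0.
Proof.
have [a [c [nz_ac root_ac]]] := quadratic_root (hessA x) (hessB x) (hessC x).
have [b [d det1]] : exists b d, a * d - b * c = 1.
  case/orP: nz_ac => nz; first by exists 0, a^-1; field.
  by exists (- c^-1), 0; field.
exists (pullback a b c d x); first by exists a, b, c, d.
by rewrite hessA_pullback root_ac mulr0.
Qed.

(** When the Hessian is y (k x + l y), its nonzero discriminant forces k <> 0,
    so a shear that fixes the first basis vector removes the y^2 term. *)
Lemma hessC_shear x : invD x != 0 -> hessA x = 0 ->
  exists2 y, sl_equiv x y & hessA y = 0 /\ hessC y = 0.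
Proof.
move=> nzD hA0; have nzB : hessB x != 0.
  have := hess_disc x; rewrite hA0 mulr0 mul0r subr0 => EB.
  rewrite -sqrf_eq0 EB mulf_neq0 // oppr_eq0.
  exact: (nat23_neq0 4 1 char_neq2 char_neq3).
pose b := - hessC x / hessB x.
exists (pullback 1 b 0 1 x); first by exists 1, b, 0, 1; split=> //; ring.
by rewrite hessA_pullback hessC_pullback hA0 /b; split; field.
Qed.

(** Here 3 A C = B^2 and 3 B D = C^2.  Multiplying gives
    B C (B C - 9 A D) = 0, and the second factor is the remaining coefficient
    of the Hessian up to a scalar, so it is nonzero. *)
Lemma hess_diag x : invD x != 0 -> hessA x = 0 -> hessC x = 0 ->
  xB x = 0 /\ xC x = 0.
Proof.
have nz4 := nat23_neq0 2 0 char_neq2 char_neq3.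
move=> nzD /eqP; rewrite mulf_eq0 (negPf nz4) /=.
rewrite subr_eq0 => /eqP EB /eqP; rewrite mulf_eq0 (negPf nz4) subr_eq0 /=.
move=> /eqP EC; have E : xB x * xC x = 0.
  apply/eqP; apply: contraR nzD => nzBC.
  have E9 : xB x * xC x = 9%:R * xA x * xD x.
    apply: (mulfI nzBC); transitivity (xB x ^+ 2 * xC x ^+ 2); first by ring.
    by rewrite -EB -EC; ring.
  have: hessB x = 0 by rewrite /hessB E9 subrr mulr0.
  have := hess_disc x; rewrite /hessA EB subrr => /esym + hB0.
  rewrite hB0 expr0n /= !(mulr0, mul0r) subr0 => /eqP; rewrite mulf_eq0 oppr_eq0.
  by rewrite (negPf (nat23_neq0 4 1 char_neq2 char_neq3)).
have [B0|nzB] := eqVneq (xB x) 0.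
  by split=> //; apply/eqP; rewrite -sqrf_eq0 -EC B0 mulr0 mul0r.
have C0 : xC x = 0 by apply: (mulfI nzB); rewrite E mulr0.
by case/negP: nzB; rewrite -sqrf_eq0 -EB C0 mulr0.
Qed.

(** With the Hessian diagonalised the cubic is A x^3 + D y^3, and diag(r, 1/r)
    with r^3 = 1/A makes the first coefficient 1. *)
Lemma diag_form_exists x : invD x != 0 ->
  exists d s t : F, sl_equiv x (diag_form d s t).
Proof.
move=> nzDx; have [y xy hA] := hessA_root x.
have DE (u v : cubvec F) : sl_equiv u v -> invD v = invD u.
  by move/sl_equiv_invariants => [].
have nzDy : invD y != 0 by rewrite (DE x).
have [z yz [hAz hCz]] := hessC_shear nzDy hA.
have nzDz : invD z != 0 by rewrite (DE y).
have [B0 C0] := hess_diag nzDz hAz hCz.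
have nzA : xA z != 0.
  by apply: contra nzDz => /eqP A0; rewrite /invD A0 B0 C0; apply/eqP; ring.
have [r Dr] := root_exists (xA z)^-1 (isT : 0 < 3)%N.
have nzr : r != 0 by rewrite -cube_eq0 Dr invr_eq0.
exists (cub z 0 r^-1), (r^-1 * xs z), (r * xt z).
apply/(sl_equiv_trans xy)/(sl_equiv_trans yz).
exists r, 0, 0, r^-1; split; first by field.
rewrite /pullback /diag_form B0 C0 /cub B0 C0; f_equal; try ring.
by rewrite Dr; field.
Qed.

(** A quarter turn exchanges the two cubes at the cost of a sign; rescaling by
    a cube root of d restores the coefficient 1. *)
Lemma diag_form_opp (d s t : F) : d != 0 ->
  exists s' t', sl_equiv (diag_form d s t) (diag_form (- d) s' t').
Proof.
move=> nz_d; have [r Dr] := root_exists d (isT : 0 < 3)%N.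
have nzr : r != 0 by rewrite -cube_eq0 Dr.
exists (r * t), (- r^-1 * s), 0, (- r), r^-1, 0; split; first by field.
rewrite /pullback /diag_form /cub /= -Dr; f_equal; field => //.
Qed.

(** The discriminant leaves only the sign of d open, so either square root of
    - D / 27 may be imposed; two pairs with the same discriminant can then be
    compared in the same normal form. *)
Lemma diag_form_at x (d : F) : invD x != 0 -> invD x = - 27%:R * d ^+ 2 ->
  exists s t : F, sl_equiv x (diag_form d s t).
Proof.
move=> nzD Dd; have [d0 [s [t xy]]] := diag_form_exists nzD.
have nz27 : - 27%:R != 0 :> F.
  by rewrite oppr_eq0; exact: (nat23_neq0 0 3 char_neq2 char_neq3).
have [+ _ _ _] := sl_equiv_invariants xy; rewrite invD_diag Dd => /(mulfI nz27)/eqP.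
have nz_d0 : d0 != 0.
  have [Ed _ _ _] := sl_equiv_invariants xy; apply: contra nzD => /eqP d0_0.
  by rewrite Ed invD_diag d0_0 expr0n mulr0.
rewrite eqf_sqr => /orP[]/eqP->; first by exists s, t.
have [s' [t' yz]] := diag_form_opp s t nz_d0.
by exists s', t'; apply: sl_equiv_trans yz.
Qed.

(** The ratio of s and s' (or of t' and t) is the root of unity; when both s
    and t vanish there is nothing to correct. *)
Lemma root3_unity_twist (s t s' t' : F) :
    s ^+ 3 = s' ^+ 3 -> t ^+ 3 = t' ^+ 3 -> s * t = s' * t' ->
  exists z, [/\ z ^+ 3 = 1, s' = z^-1 * s & t' = z * t].
Proof.
move=> Es Et Est; have [s0|nz_s] := eqVneq s 0.
  have s'0 : s' = 0 by apply/eqP; rewrite -cube_eq0 -Es s0 expr0n.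
  have [t0|nz_t] := eqVneq t 0.
    have t'0 : t' = 0 by apply/eqP; rewrite -cube_eq0 -Et t0 expr0n.
    by exists 1; rewrite s0 s'0 t0 t'0 !mulr0 expr1n.
  exists (t' / t); rewrite s0 s'0 mulr0 divfK // expr_div_n -Et divff //.
  by rewrite cube_eq0.
have nz_s' : s' != 0 by rewrite -cube_eq0 -Es cube_eq0.
exists (s / s'); rewrite expr_div_n Es divff ?cube_eq0 //; split=> //.
  by field; rewrite nz_s'.
by rewrite mulrAC Est mulrAC divff // mul1r.
Qed.

Lemma disc_sqrt (D : F) : D != 0 -> exists2 d, d != 0 & D = - 27%:R * d ^+ 2.
Proof.
move=> nzD; have nz27 := nat23_neq0 0 3 char_neq2 char_neq3.
have [d Dd] := root_exists (- D / 27%:R) (isT : 0 < 2)%N.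
have ED : D = - 27%:R * d ^+ 2 by rewrite Dd; field.
by exists d => //; apply: contra nzD => /eqP d0; rewrite ED d0 expr0n mulr0.
Qed.

(** In a common normal form P +/- G / (108 d) are 2 s^3 and 2 d t^3, and
    H / (36 d) is s t.  The remaining ambiguity in (s, t) is a cube root of
    unity z, and diag(z, 1/z) fixes x^3 + d y^3. *)
Lemma sl_equiv_of_invariants x y :
  invD x != 0 -> invariants x = invariants y -> sl_equiv x y.
Proof.
move=> nzDx Exy; have nzDy : invD y != 0 by case: Exy => <-.
have [d nzd Dd] := disc_sqrt nzDx.
have [s [t xz]] := diag_form_at nzDx Dd.
have [s' [t' yz']] : exists s t : F, sl_equiv y (diag_form d s t).
  by apply: diag_form_at; case: Exy => <-.
apply: (sl_equiv_trans xz (sl_equiv_trans _ (sl_equiv_sym yz'))).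
have : invariants (diag_form d s t) = invariants (diag_form d s' t').
  by rewrite -(sl_equiv_invariants xz) -(sl_equiv_invariants yz').
case/eq_invariants=> _; rewrite !invP_diag !invH_diag !invG_diag => EP.
move/(mulfI (mulf_neq0 (nat23_neq0 2 2 char_neq2 char_neq3) nzd)) => EH.
move/(mulfI (mulf_neq0 (nat23_neq0 2 3 char_neq2 char_neq3) nzd)) => EG.
have Es : s ^+ 3 = s' ^+ 3.
  apply: (mulfI nz2); transitivity ((s ^+ 3 + d * t ^+ 3) + (s ^+ 3 - d * t ^+ 3)).
    by ring.
  by rewrite EP EG; ring.
have Et : t ^+ 3 = t' ^+ 3 by move: EP; rewrite Es => /addrI/(mulfI nzd).
have [z [z3 -> ->]] := root3_unity_twist Es Et EH.
have nzz : z != 0 by rewrite -cube_eq0 z3 oner_eq0.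
exists z, 0, 0, z^-1; split; first by field.
rewrite /pullback /diag_form /cub /=; f_equal; try ring.
  by rewrite z3; ring.
by rewrite (exprVn z 3) z3 invr1; ring.
Qed.

(** Choosing any cube root s of u, the equation s t = c determines t unless
    u = 0, and then c = 0 as well, so any cube root t of v will do. *)
Lemma cubes_with_product (u v c : F) : u * v = c ^+ 3 ->
  exists s t, [/\ s ^+ 3 = u, t ^+ 3 = v & s * t = c].
Proof.
move=> Euv; have [s Ds] := root_exists u (isT : 0 < 3)%N.
have [u0|nz_u] := eqVneq u 0.
  have [t Dt] := root_exists v (isT : 0 < 3)%N.
  exists s, t; split=> //; have -> : s = 0 by apply/eqP; rewrite -cube_eq0 Ds u0.
  by apply/esym/eqP; rewrite mul0r -cube_eq0 -Euv u0 mul0r.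
have nz_s : s != 0 by rewrite -cube_eq0 Ds.
exists s, (c / s); split=> //; last by rewrite mulrC divfK.
by rewrite expr_div_n Ds -Euv mulrAC divff // mul1r.
Qed.

(** The normal form is solved for (s, t); after the substitution G = 108 d K,
    H = 36 d L the syzygy is the compatibility condition of
    [cubes_with_product]. *)
Lemma invariants_onto (D P H G : F) : D != 0 ->
    G ^+ 2 + H ^+ 3 + 432%:R * P ^+ 2 * D = 0 ->
  exists x, invariants x = (D, P, H, G).
Proof.
move=> nzD; have [d nzd ->] := disc_sqrt nzD.
have nz108d : 108%:R * d != 0.
  exact: mulf_neq0 (nat23_neq0 2 3 char_neq2 char_neq3) nzd.
have nz36d : 36%:R * d != 0.
  exact: mulf_neq0 (nat23_neq0 2 2 char_neq2 char_neq3) nzd.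
rewrite -[G](divfK nz108d) -[H](divfK nz36d).
move: (G / _) (H / _) => K L syz.
have EL : P ^+ 2 - K ^+ 2 = 4%:R * d * L ^+ 3.
  apply/eqP; rewrite eq_sym -subr_eq0; apply/eqP/(mulfI (mulf_neq0 nz108d nz108d)).
  by rewrite mulr0 -[RHS]syz; ring.
have [s [t [Ds Dt Dst]]] : exists s t,
    [/\ s ^+ 3 = (P + K) / 2%:R, t ^+ 3 = (P - K) / (2%:R * d) & s * t = L].
  apply: cubes_with_product; transitivity ((P ^+ 2 - K ^+ 2) / (4%:R * d)).
    by field; rewrite nzd nz2 (nat23_neq0 2 0 char_neq2 char_neq3).
  by rewrite EL; field; rewrite nzd (nat23_neq0 2 0 char_neq2 char_neq3).
exists (diag_form d s t); rewrite /invariants.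
rewrite invD_diag invP_diag invH_diag invG_diag Ds Dt Dst.
congr (_, _, _, _); field; by rewrite ?nzd ?nz2.
Qed.

End ClosedField.

(** * The special linear group of a plane *)

Lemma det_mx22 (R : comPzRingType) (M : 'M[R]_2) :
  \det M = M 0 0 * M 1 1 - M 0 1 * M 1 0.
Proof.
have l0 : lift ord0 ord0 = 1 :> 'I_2 by exact: val_inj.
have l1 : lift 1 ord0 = 0 :> 'I_2 by exact: val_inj.
rewrite (expand_det_row _ ord0) big_ord_recl big_ord1 /cofactor !det_mx11 !mxE l0 l1.
by rewrite /= expr0 expr1 mul1r mulN1r mulrN.
Qed.

Section Plane.
Variables (F : fieldType) (V : vectType F) (e : 2.-tuple V).
Hypotheses (dimV : \dim {:V} = 2%N) (e_basis : basis_of {:V} e).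
Local Notation bilmap := 'Hom(V, 'Hom(V, V)).
Local Notation co i v := (coord e i v : F).

(** The length of b is a variable so that it can be replaced by the dimension,
    which is the length that matrices of linear maps require. *)
Lemma det_mxof_indep n (b : n.-tuple V) (g : 'End(V)) :
    \dim {:V} = n -> basis_of {:V} b ->
  \det (passmx.mxof (vbasis {:V}) (vbasis {:V}) g)
    = \det (\matrix_(i, j) coord b j (g b`_i)).
Proof.
move=> dimVn; case: _ / dimVn b => b b_basis.
have u_basis := vbasisP {:V}; set u := vbasis {:V} in u_basis *.
have -> : \matrix_(i, j) coord b j (g b`_i) = passmx.mxof b b g.
  by apply/matrixP=> i j; rewrite !mxE /= passmx.vecof_delta.
have mxofK : passmx.mxof u b \1 *m passmx.mxof b u \1 = 1%:M.
  by rewrite -passmx.mxof_comp // comp_lfun1l passmx.mxof1 // (basis_free u_basis).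
rewrite -[in LHS](comp_lfun1l g) -[in LHS](comp_lfun1r g).
rewrite (passmx.mxof_comp u u b_basis) (passmx.mxof_comp u b b_basis).
by rewrite !det_mulmx mulrC mulrCA mulrA -det_mulmx mxofK det1 mul1r.
Qed.

(** The endomorphism with matrix rows (a, b) and (c, d), acting on columns of
    coordinates. *)
Definition mxend (a b c d : F) : 'End(V) :=
  linfun (fun v => (a * co 0 v + b * co 1 v) *: e`_0
                 + (c * co 0 v + d * co 1 v) *: e`_1).

Lemma mxendE a b c d v : mxend a b c d v =
  (a * co 0 v + b * co 1 v) *: e`_0 + (c * co 0 v + d * co 1 v) *: e`_1.
Proof.
apply: (linfun_linE (f := fun v => _)) => k x y.
rewrite !(linearP (coord e _)) scalerDr addrACA !scalerA -!scalerDl.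
by congr (_ *: _ + _ *: _); rewrite /GRing.scale /=; ring.
Qed.

Lemma coord_comb i (x y : F) :
  co i (x *: e`_0 + y *: e`_1) = x * (i == 0)%:R + y * (i == 1)%:R.
Proof. by rewrite linearD !linearZ /= (coord_e e_basis i 0) (coord_e e_basis i 1). Qed.

Lemma coord0_comb (x y : F) : co 0 (x *: e`_0 + y *: e`_1) = x.
Proof. by rewrite coord_comb /= mulr1 mulr0 addr0. Qed.

Lemma coord1_comb (x y : F) : co 1 (x *: e`_0 + y *: e`_1) = y.
Proof. by rewrite coord_comb /= mulr1 mulr0 add0r. Qed.

Lemma mxend_comp a b c d a' b' c' d' :
  (mxend a b c d \o mxend a' b' c' d')%VF =
  mxend (a * a' + b * c') (a * b' + b * d') (c * a' + d * c') (c * b' + d * d').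
Proof.
apply/lfunP=> v; rewrite comp_lfunE !mxendE coord0_comb coord1_comb.
by congr (_ *: _ + _ *: _); ring.
Qed.

Lemma mxend1 : mxend 1 0 0 1 = \1%VF.
Proof.
apply/lfunP=> v; rewrite mxendE id_lfunE [RHS](e_span e_basis).
by congr (_ *: _ + _ *: _); ring.
Qed.

Lemma mxend_adj a b c d : a * d - b * c = 1 ->
  (mxend d (- b) (- c) a \o mxend a b c d)%VF = \1%VF.
Proof.
move=> det1; rewrite mxend_comp -mxend1; congr mxend; rewrite -?det1; ring.
Qed.

Lemma mxend_inv a b c d : a * d - b * c = 1 ->
  (mxend a b c d)^-1%VF = mxend d (- b) (- c) a.
Proof.
move=> det1; set g := mxend a b c d; set h := mxend d _ _ _.
have hgK : cancel g h.
  by move=> v; rewrite -comp_lfunE mxend_adj // id_lfunE.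
have ghK : cancel h g.
  move=> v; rewrite -comp_lfunE; have := @mxend_adj d (- b) (- c) a.
  by rewrite !opprK => -> //; rewrite ?id_lfunE // -det1; ring.
have g_inj : lker g == 0%VS by apply/lker0P/can_inj/hgK.
by apply/lfunP=> v; rewrite -{1}[v]ghK lker0_lfunK.
Qed.

Lemma mxend_coef (g : 'End(V)) :
  g = mxend (co 0 (g e`_0)) (co 0 (g e`_1)) (co 1 (g e`_0)) (co 1 (g e`_1)).
Proof.
apply/lfunP=> v; rewrite mxendE {1}(e_span e_basis v) linearD !linearZ /=.
rewrite {1}(e_span e_basis (g e`_0)) {1}(e_span e_basis (g e`_1)).
rewrite !scalerDr addrACA !scalerA -!scalerDl.
by congr (_ *: _ + _ *: _); ring.
Qed.

Lemma SL_mxend a b c d : SL (mxend a b c d) = (a * d - b * c == 1).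
Proof.
rewrite /SL (det_mxof_indep _ dimV e_basis) det_mx22 !mxE !mxendE.
rewrite !coord0_comb !coord1_comb (coord_e e_basis 0 0) (coord_e e_basis 0 1).
rewrite (coord_e e_basis 1 0) (coord_e e_basis 1 1) /=.
by congr (_ == _); ring.
Qed.

(** The entries are those of the inverse of g, since m is acted on through
    that inverse. *)
Lemma SLP (g : 'End(V)) : SL g ->
  exists a b c d, a * d - b * c = 1 /\ g = mxend d (- b) (- c) a.
Proof.
rewrite {1}(mxend_coef g) SL_mxend => /eqP det1.
exists (co 1 (g e`_1)), (- co 0 (g e`_1)), (- co 1 (g e`_0)), (co 0 (g e`_0)).
by split; [rewrite -det1; ring | rewrite !opprK -mxend_coef].
Qed.

Lemma SL_adj a b c d : a * d - b * c = 1 -> SL (mxend d (- b) (- c) a).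
Proof. by move=> det1; rewrite SL_mxend -det1; apply/eqP; ring. Qed.

Lemma SL1 : SL (\1%VF : 'End(V)).
Proof. by rewrite -mxend1 SL_mxend; apply/eqP; ring. Qed.

Lemma SL_comp (g h : 'End(V)) : SL g -> SL h -> SL (g \o h)%VF.
Proof.
rewrite {1 2}(mxend_coef g) {1 2}(mxend_coef h) !SL_mxend => /eqP det1 /eqP det1'.
rewrite mxend_comp SL_mxend; apply/eqP.
by have := congr2 *%R det1 det1'; rewrite mulr1 => <-; ring.
Qed.

Lemma SL_inv (g : 'End(V)) : SL g -> SL (g^-1)%VF.
Proof.
move=> /SLP[a [b [c [d [det1 ->]]]]]; have det1' : d * a - - b * - c = 1.
  by rewrite -det1; ring.
by rewrite (mxend_inv det1') SL_mxend -det1; apply/eqP; ring.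
Qed.

Lemma SL_lker0 (g : 'End(V)) : SL g -> lker g == 0%VS.
Proof.
move=> /SLP[a [b [c [d [det1 ->]]]]].
have det1' : d * a - - b * - c = 1 by rewrite -det1; ring.
apply/lker0P => v w /(congr1 (mxend a (- - b) (- - c) d)).
by rewrite -!comp_lfunE (mxend_adj det1') !id_lfunE.
Qed.

Lemma gact1 (m : bilmap) : gact \1%VF m = m.
Proof.
apply/lfunP=> v; apply/lfunP=> w; rewrite gactE.
have inv1 : (\1^-1)%VF = \1%VF :> 'End(V).
  have det1 : 1 * 1 - 0 * 0 = 1 :> F by ring.
  by rewrite -mxend1 mxend_inv // oppr0.
by rewrite inv1 !id_lfunE.
Qed.

Lemma gact_comp g h (m : bilmap) : SL g -> SL h ->
  gact g (gact h m) = gact (g \o h)%VF m.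
Proof.
move=> SLg SLh; apply/lfunP=> v; apply/lfunP=> w; rewrite !gactE comp_lfunE.
have inv_comp u : ((g \o h)^-1)%VF u = (h^-1)%VF ((g^-1)%VF u).
  have := lker0_lfunVK (SL_lker0 SLg) u => {1}<-.
  have := lker0_lfunVK (SL_lker0 SLh) ((g^-1)%VF u) => {1}<-.
  by rewrite -comp_lfunE lker0_lfunK // SL_lker0 // SL_comp.
by rewrite !inv_comp.
Qed.

Lemma gactK g (m : bilmap) : SL g -> gact (g^-1)%VF (gact g m) = m.
Proof.
move=> SLg; rewrite gact_comp ?SL_inv // -[RHS]gact1; congr gact.
by rewrite lker0_compVf // SL_lker0.
Qed.

Lemma gact_sym g (m : bilmap) : m \in symbil V V -> gact g m \in symbil V V.
Proof. by move=> /symbilP sym_m; apply/symbilP => v w; rewrite !gactE sym_m. Qed.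

Lemma SLorbit_refl (m : bilmap) : SLorbit m m.
Proof. by exists \1%VF; rewrite ?gact1 ?SL1. Qed.

(** Orbits are predicates, so equality of orbits rests on extensionality. *)
Lemma SLorbit_eq (m m' : bilmap) : SLorbit m m' -> SLorbit m = SLorbit m'.
Proof.
move=> [g SLg ->]; apply/funext => n; apply/propext; split=> [] [h SLh ->].
  exists (h \o g^-1)%VF; first by rewrite SL_comp ?SL_inv.
  by rewrite -gact_comp ?SL_inv // gactK.
by exists (h \o g)%VF; rewrite ?gact_comp ?SL_comp.
Qed.

Lemma sval_inj (T : Type) (P : T -> Prop) : injective (@sval T P).
Proof. by move=> [x Px] [y Py] /= E; apply: eq_exist. Qed.

(** The map on the quotient is evaluated on a chosen representative of each
    orbit, and its inverse picks a preimage of each value; f being invariant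
    and separating orbits makes the choices irrelevant. *)
Lemma SLbijection_of_separating (Y : Type) (D : bilmap -> bool) (E : Y -> bool) f :
    (forall g m, SL g -> D m -> D (gact g m)) ->
    (forall g m, SL g -> D m -> f (gact g m) = f m) ->
    (forall m, D m -> E (f m)) ->
    (forall m m', D m -> D m' -> f m = f m' -> SLorbit m m') ->
    (forall y, E y -> exists2 m, D m & f m = y) ->
  SLbijection D E f.
Proof.
move=> stabD invf DE f_inj f_onto; split=> //.
have rep (O : SLquotient D) : {m | D m & sval O = SLorbit m}.
  exact: (cid2 (svalP O)).
have sec (y : {y : Y | E y}) : {m | D m & f m = sval y}.
  exact: (cid2 (f_onto _ (svalP y))).
pose h O := exist (fun y => E y) (f (s2val (rep O))) (DE _ (s2valP (rep O))).
have hE O m : D m -> sval O m -> sval (h O) = f m.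
  move=> Dm; rewrite (s2valP' (rep O)) => -[g SLg ->] /=.
  by rewrite invf // (s2valP (rep O)).
exists h; split=> //.
have orbP m : D m -> exists2 m0, D m0 & SLorbit m = SLorbit m0 by exists m.
pose k y : SLquotient D :=
  exist _ (SLorbit (s2val (sec y))) (orbP _ (s2valP (sec y))).
exists k => [O|y].
  apply: sval_inj; rewrite (s2valP' (rep O)); apply/esym/SLorbit_eq/f_inj.
  - exact: (s2valP (rep O)).
  - exact: (s2valP (sec _)).
  - by rewrite (s2valP' (sec (h O))).
apply: sval_inj; rewrite -[RHS](s2valP' (sec y)).
apply: hE; [exact: (s2valP (sec y)) | exact: SLorbit_refl].
Qed.

End Plane.

(** * Formal covariants and their values *)

Section PolynomialDerivatives.
Variable R : comNzRingType.

Lemma mderivXU n (i j : 'I_n) : ('X_i : {mpoly R[n]})^`M(j) = (i == j)%:R.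
Proof.
rewrite mderivX mnm1E; case: eqP => [-> | _]; last by rewrite scale0r.
rewrite scale1r (_ : (U_(j) - U_(j) = 0)%MM) ?mpolyX0 //.
by apply/mnmP=> k; rewrite mnmBE mnm0E subnn.
Qed.

Lemma mderiv1 n (i : 'I_n) : (1 : {mpoly R[n]})^`M(i) = 0.
Proof. by rewrite -mpolyC1 mderivC. Qed.

End PolynomialDerivatives.

Ltac mpoly_ring :=
  rewrite ?(mderivD, mderivZ, mderivM, exprS, expr0, mderivXU, mderiv1) /=
  -?mul_mpolyC !(mpolyCD, mpolyCB, mpolyCN, mpolyCM, rmorphXn, mpolyC_nat); ring.

Section BinaryForms.
Variable R : comNzRingType.

Definition binlin (a b : R) : {mpoly R[2]} := a *: 'X_0 + b *: 'X_1.
Definition binquad (a b c : R) : {mpoly R[2]} :=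
  a *: 'X_0 ^+ 2 + b *: ('X_0 * 'X_1) + c *: 'X_1 ^+ 2.

Lemma binquad_d0 a b c : (binquad a b c)^`M(0) = binlin (2%:R * a) b.
Proof. rewrite /binlin /binquad; mpoly_ring. Qed.

Lemma binquad_d1 a b c : (binquad a b c)^`M(1) = binlin b (2%:R * c).
Proof. rewrite /binlin /binquad; mpoly_ring. Qed.

Lemma binlin_eval a b (v : 'I_2 -> R) : (binlin a b).@[v] = a * v 0 + b * v 1.
Proof. by rewrite mevalD !mevalZ !mevalXU. Qed.

Lemma binquad_eval a b c (v : 'I_2 -> R) :
  (binquad a b c).@[v] = a * v 0 ^+ 2 + b * (v 0 * v 1) + c * v 1 ^+ 2.
Proof. by rewrite !mevalD !mevalZ !(mevalM, rmorphXn) /= !mevalXU. Qed.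

End BinaryForms.

(** * Symmetric multiplications as cubics with a vector *)

Section Coefficients.
Variables (F : fieldType) (V : vectType F) (e : 2.-tuple V).
Hypothesis (e_basis : basis_of {:V} e).
Local Notation bilmap := 'Hom(V, 'Hom(V, V)).
Local Notation co i v := (coord e i v : F).
Implicit Type m : bilmap.

Definition coords m : cubvec F :=
  CubVec (cubA e m) (cubB e m) (cubC e m) (cubD e m) (tau e m 0) (tau e m 1).

Lemma cubic_tau m : (cubic e m).@[tau e m] = invP (coords m).
Proof. exact: cubicE. Qed.

Lemma cubic_d0 m :
  (cubic e m)^`M(0) = binquad (3%:R * cubA e m) (2%:R * cubB e m) (cubC e m).
Proof. rewrite /binquad /cubic; mpoly_ring. Qed.

Lemma cubic_d1 m :
  (cubic e m)^`M(1) = binquad (cubB e m) (2%:R * cubC e m) (3%:R * cubD e m).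
Proof. rewrite /binquad /cubic; mpoly_ring. Qed.

Lemma hessianE m :
  hessian e m = binquad (hessA (coords m)) (hessB (coords m)) (hessC (coords m)).
Proof.
rewrite /hessian cubic_d0 cubic_d1 !binquad_d0 !binquad_d1.
rewrite /hessA /hessB /hessC /coords /= /binquad /binlin; mpoly_ring.
Qed.

Lemma hessian_tau m : (hessian e m).@[tau e m] = invH (coords m).
Proof. by rewrite hessianE binquad_eval. Qed.

Lemma covariantG_tau m : (covariantG e m).@[tau e m] = invG (coords m).
Proof.
rewrite /covariantG hessianE binquad_d0 binquad_d1 cubic_d0 cubic_d1.
by rewrite mevalB !mevalM !binquad_eval !binlin_eval.
Qed.

Lemma coord_bilin i m u v : co i (m u v) =
    co 0 u * co 0 v * co i (m e`_0 e`_0) + co 0 u * co 1 v * co i (m e`_0 e`_1)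
  + co 1 u * co 0 v * co i (m e`_1 e`_0) + co 1 u * co 1 v * co i (m e`_1 e`_1).
Proof.
have comb (W : vectType F) (f : 'Hom(V, W)) w :
  f w = co 0 w *: f e`_0 + co 1 w *: f e`_1.
  by rewrite {1}(e_span e_basis w) linearD !linearZ.
have coZD k l x y : co i (k *: x + l *: y) = k * co i x + l * co i y.
  by rewrite linearD !linearZ.
rewrite (comb _ m) !(add_lfunE, scale_lfunE) (comb _ (m _) v) (comb _ (m e`_1) v).
by rewrite !coZD; ring.
Qed.

Lemma tau0E m : tau e m 0 = coef_d e m + coef_e e m. Proof. by []. Qed.
Lemma tau1E m : tau e m 1 = - (coef_a e m + coef_f e m). Proof. by []. Qed.

(** The action of g on m is the change of variables by the inverse of g, whose
    matrix has rows (a, b) and (c, d). *)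
Lemma coords_gact a b c d m : a * d - b * c = 1 -> m \in symbil V V ->
  coords (gact (mxend e d (- b) (- c) a) m) = pullback a b c d (coords m).
Proof.
move=> det1 /symbilP m_sym.
have inv_g : (mxend e d (- b) (- c) a)^-1%VF = mxend e a b c d.
  by rewrite mxend_inv // ?opprK // -det1; ring.
have ce := coord_e e_basis.
have h0 i : co i (mxend e a b c d e`_0) = if i == 0 then a else c.
  rewrite mxendE (ce 0 0) (ce 1 0) coord_comb //.
  by case: i => [[|[|//]] ?] /=; ring.
have h1 i : co i (mxend e a b c d e`_1) = if i == 0 then b else d.
  rewrite mxendE (ce 0 1) (ce 1 1) coord_comb //.
  by case: i => [[|[|//]] ?] /=; ring.
set g := mxend e d _ _ a in inv_g *; set h := mxend e a b c d in inv_g h0 h1.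
have mh u v : gact g m u v = g (m (h u) (h v)) by rewrite gactE inv_g.
have g0 v : co 0 (g v) = d * co 0 v - b * co 1 v.
  by rewrite mxendE coord0_comb // mulNr.
have g1 v : co 1 (g v) = a * co 1 v - c * co 0 v.
  by rewrite mxendE coord1_comb //; ring.
have mh00 i : co i (m (h e`_0) (h e`_0)) = a ^+ 2 * co i (m e`_0 e`_0)
    + 2%:R * a * c * co i (m e`_0 e`_1) + c ^+ 2 * co i (m e`_1 e`_1).
  by rewrite coord_bilin !h0 /= (m_sym e`_1 e`_0); ring.
have mh01 i : co i (m (h e`_0) (h e`_1)) = a * b * co i (m e`_0 e`_0)
    + (a * d + b * c) * co i (m e`_0 e`_1) + c * d * co i (m e`_1 e`_1).
  by rewrite coord_bilin !h0 !h1 /= (m_sym e`_1 e`_0); ring.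
have mh11 i : co i (m (h e`_1) (h e`_1)) = b ^+ 2 * co i (m e`_0 e`_0)
    + 2%:R * b * d * co i (m e`_0 e`_1) + d ^+ 2 * co i (m e`_1 e`_1).
  by rewrite coord_bilin !h1 /= (m_sym e`_1 e`_0); ring.
have Ea : coef_a e (gact g m) = d * (a ^+ 2 * coef_a e m
  + 2%:R * a * c * coef_e e m + c ^+ 2 * coef_c e m) - b * (a ^+ 2 * coef_b e m
  + 2%:R * a * c * coef_f e m + c ^+ 2 * coef_d e m) by rewrite /coef_a mh g0 !mh00.
have Eb : coef_b e (gact g m) = a * (a ^+ 2 * coef_b e m
  + 2%:R * a * c * coef_f e m + c ^+ 2 * coef_d e m) - c * (a ^+ 2 * coef_a e m
  + 2%:R * a * c * coef_e e m + c ^+ 2 * coef_c e m) by rewrite /coef_b mh g1 !mh00.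
have Ee : coef_e e (gact g m) = d * (a * b * coef_a e m
  + (a * d + b * c) * coef_e e m + c * d * coef_c e m) - b * (a * b * coef_b e m
  + (a * d + b * c) * coef_f e m + c * d * coef_d e m) by rewrite /coef_e mh g0 !mh01.
have Ef : coef_f e (gact g m) = a * (a * b * coef_b e m
  + (a * d + b * c) * coef_f e m + c * d * coef_d e m) - c * (a * b * coef_a e m
  + (a * d + b * c) * coef_e e m + c * d * coef_c e m) by rewrite /coef_f mh g1 !mh01.
have Ec : coef_c e (gact g m) = d * (b ^+ 2 * coef_a e m
  + 2%:R * b * d * coef_e e m + d ^+ 2 * coef_c e m) - b * (b ^+ 2 * coef_b e m
  + 2%:R * b * d * coef_f e m + d ^+ 2 * coef_d e m) by rewrite /coef_c mh g0 !mh11.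
have Ed : coef_d e (gact g m) = a * (b ^+ 2 * coef_b e m
  + 2%:R * b * d * coef_f e m + d ^+ 2 * coef_d e m) - c * (b ^+ 2 * coef_a e m
  + 2%:R * b * d * coef_e e m + d ^+ 2 * coef_c e m) by rewrite /coef_d mh g1 !mh11.
rewrite /coords /pullback /cub /cubA /cubB /cubC /cubD !tau0E !tau1E.
cbn [xA xB xC xD xs xt]; rewrite Ea Eb Ec Ed Ee Ef.
move: (coef_a e m) (coef_b e m) (coef_c e m) (coef_d e m) (coef_e e m) (coef_f e m).
clear -det1 => A B C D E1 E2.
f_equal; try ring.
(* The two remaining goals are the coordinates of the trace vector, which is
   multiplied by the adjugate up to a factor of determinant. *)
  by rewrite -[RHS]mul1r -[X in _ = X * _]det1; ring.
by rewrite -[RHS]mul1r -[X in _ = X * _]det1; ring.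
Qed.

Hypothesis nz3 : 3%:R != 0 :> F.

(** B and t are a - 2 f and - (a + f) in terms of the structure constants, so
    together they give 3 f, and likewise C and s give 3 e. *)
Lemma coords_inj m m' : m \in symbil V V -> m' \in symbil V V ->
  coords m = coords m' -> m = m'.
Proof.
move=> /symbilP m_sym /symbilP m'_sym [].
rewrite /cubA /cubB /cubC /cubD !tau0E !tau1E => /oppr_inj Eb EB EC Ec Et0 /oppr_inj Et1.
have Ef : coef_f e m = coef_f e m'.
  apply: (mulfI nz3); transitivity ((coef_a e m + coef_f e m)
    - (coef_a e m - 2%:R * coef_f e m)); first by ring.
  by rewrite EB Et1; ring.
have Ee : coef_e e m = coef_e e m'.
  apply: (mulfI nz3); transitivity ((coef_d e m + coef_e e m)
    + (2%:R * coef_e e m - coef_d e m)); first by ring.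
  by rewrite EC Et0; ring.
have Ea : coef_a e m = coef_a e m' by move: Et1; rewrite Ef => /addIr.
have Ed : coef_d e m = coef_d e m' by move: Et0; rewrite Ee => /addIr.
apply/lfunP=> u; apply/lfunP=> v.
rewrite (e_span e_basis (m u v)) (e_span e_basis (m' u v)).
have m10 := m_sym e`_1 e`_0; have m'10 := m'_sym e`_1 e`_0.
congr (_ *: _ + _ *: _); rewrite (coord_bilin _ m) (coord_bilin _ m') m10 m'10.
  by congr (_ * _ + _ * _ + _ * _ + _ * _); first [exact: Ea | exact: Ee | exact: Ec].
by congr (_ * _ + _ * _ + _ * _ + _ * _); first [exact: Eb | exact: Ef | exact: Ed].
Qed.

Definition symform (p q r : F) (u v : V) : F :=
  p * (co 0 u * co 0 v) + q * (co 0 u * co 1 v + co 1 u * co 0 v)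
  + r * (co 1 u * co 1 v).

(** Inverting [coords] means solving the linear system for [coef_e] and
    [coef_f] from (C, s) and (B, t), which is where 3 is inverted; the other
    four coefficients follow. *)
Definition of_coords (x : cubvec F) : bilmap :=
  let f := - (xB x + xt x) / 3%:R in let e' := (xC x + xs x) / 3%:R in
  bilfun (fun u v => symform (- f - xt x) e' (xD x) u v *: e`_0
                   + symform (- xA x) f (xs x - e') u v *: e`_1).

Lemma coords_onto x : exists2 m, m \in symbil V V & coords m = x.
Proof.
have symformC p q r u v : symform p q r u v = symform p q r v u.
  by rewrite /symform; ring.
pose f := - (xB x + xt x) / 3%:R; pose e' := (xC x + xs x) / 3%:R.
have of_coordsE u v : of_coords x u v =
    symform (- f - xt x) e' (xD x) u v *: e`_0
    + symform (- xA x) f (xs x - e') u v *: e`_1.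
  have lin (p q r p' q' r' : F) w :
      linear (fun v => symform p q r w v *: e`_0 + symform p' q' r' w v *: e`_1).
    move=> k y z; rewrite scalerDr addrACA !scalerA -!scalerDl /symform.
    rewrite !(linearP (coord e _)).
    by congr (_ *: _ + _ *: _); rewrite /GRing.scale /=; ring.
  apply: (bilfunE (b := fun u v => _)) => [w|w]; first exact: lin.
  move=> k y z /=; rewrite ![symform _ _ _ _ w]symformC; exact: lin.
exists (of_coords x).
  apply/symbilP=> u v; rewrite !of_coordsE.
  by congr (_ *: _ + _ *: _); apply: symformC.
have ce := coord_e e_basis.
rewrite /coords !tau0E !tau1E /cubA /cubB /cubC /cubD.
rewrite /coef_a /coef_b /coef_c /coef_d /coef_e /coef_f !of_coordsE.
rewrite !coord0_comb // !coord1_comb //.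
rewrite /symform (ce 0 0) (ce 0 1) (ce 1 0) (ce 1 1) /= /f /e'.
case: x @f @e' {of_coordsE} => A B C D s t /=; f_equal; field; exact: nz3.
Qed.

End Coefficients.

(** * The three classifications *)

Section Classification.
Variables (F : closedFieldType) (V : vectType F) (e : 2.-tuple V).
Hypotheses (dimV : \dim {:V} = 2%N) (e_basis : basis_of {:V} e).
Hypothesis char_neq2 : 2%N \notin [pchar F].
Hypothesis char_neq3 : 3%N \notin [pchar F].
Local Notation bilmap := 'Hom(V, 'Hom(V, V)).
Local Notation om := (omega e).
Implicit Type m : bilmap.

Let nz3 : 3%:R != 0 :> F := nat23_neq0 0 1 char_neq2 char_neq3.
Let nz4 : 4%:R != 0 :> F := nat23_neq0 2 0 char_neq2 char_neq3.
Let nz8 : 8%:R != 0 :> F := nat23_neq0 3 0 char_neq2 char_neq3.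
Let nz54 : 54%:R != 0 :> F := nat23_neq0 1 3 char_neq2 char_neq3.

Definition on_syzygy (i : F * F * F * F) : Prop := let: (D, P, H, G) := i in
  D != 0 /\ G ^+ 2 + H ^+ 3 + 432%:R * P ^+ 2 * D = 0.

(** Orbits with nonzero discriminant being points (D, P, H, G) of the syzygy
    hypersurface, a bijection on orbits is a bijection on a subset of that
    hypersurface. *)
Lemma SLbijection_of_invariants (Y : Type) (D : bilmap -> bool) (E : Y -> bool)
    (f : bilmap -> Y) (Dx : F * F * F * F -> bool) (fx : F * F * F * F -> Y) :
    (forall m, D m = [&& m \in symbil V V, invD (coords e m) != 0
                       & Dx (invariants (coords e m))]) ->
    (forall m, D m -> f m = fx (invariants (coords e m))) ->
    (forall i, on_syzygy i -> Dx i -> E (fx i)) ->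
    (forall i j, on_syzygy i -> on_syzygy j -> Dx i -> Dx j ->
       fx i = fx j -> i = j) ->
    (forall y, E y -> exists i, [/\ on_syzygy i, Dx i & fx i = y]) ->
  SLbijection D E f.
Proof.
move=> DE fE fxE fx_inj fx_onto.
have varP m : D m ->
    on_syzygy (invariants (coords e m)) /\ Dx (invariants (coords e m)).
  by rewrite DE => /and3P[_ nzD Dxm]; split=> //; split=> //; exact: syzygy.
have symD m : D m -> m \in symbil V V by rewrite DE => /andP[].
have act g m : SL g -> m \in symbil V V ->
    invariants (coords e (gact g m)) = invariants (coords e m).
  move=> /(SLP dimV e_basis)[a [b [c [d [det1 ->]]]]] sym_m.
  by rewrite coords_gact //; apply/esym/sl_equiv_invariants; exists a, b, c, d.
have stabD g m : SL g -> D m -> D (gact g m).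
  move=> SLg Dm; have sym_m := symD m Dm; have Em := act g m SLg sym_m.
  rewrite DE gact_sym // Em; move: Dm; rewrite DE sym_m.
  by case/eq_invariants: Em => ->.
apply: (SLbijection_of_separating dimV e_basis stabD).
- by move=> g m SLg Dm; rewrite !fE ?stabD // act ?symD.
- by move=> m Dm; have [] := varP m Dm; rewrite fE //; exact: fxE.
- move=> m m' Dm Dm'; have [[Vm Dxm] [Vm' Dxm']] := (varP m Dm, varP m' Dm').
  rewrite !fE // => /(fx_inj _ _ Vm Vm' Dxm Dxm') Em.
  have nzD : invD (coords e m) != 0 by move: Vm => [].
  have [a [b [c [d [det1 Ed]]]]] :=
    sl_equiv_of_invariants char_neq2 char_neq3 nzD Em.
  exists (mxend e d (- b) (- c) a); first exact: SL_adj.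
  apply: (coords_inj e_basis nz3); rewrite ?gact_sym ?symD //.
  by rewrite coords_gact ?symD.
- move=> y /fx_onto[[[[D0 P] H] G] [[nzD syz] Dxi fxi]].
  have [x Ex] := invariants_onto char_neq2 char_neq3 nzD syz.
  have [m sym_m Em] := coords_onto e_basis nz3 x.
  have Dm : D m by rewrite DE sym_m Em Ex Dxi andbT; case: Ex => -> _ _ _.
  by exists m; rewrite ?fE // Em Ex.
Qed.

Lemma Ldiv_omega r s (x y : F) : y != 0 ->
  Ldiv r s (x *: Lexp om (r + s)) (y *: Lexp om s) = (x / y) *: Lexp om r.
Proof.
move=> nzy.
have -> : x *: Lexp om (r + s) = Lmul ((x / y) *: Lexp om r) (y *: Lexp om s).
  rewrite (lin_scale _ _ (@Lmul_linr F V r s _)).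
  rewrite (lin_scale _ _ (@Lmul_linl F V r s _)).
  by rewrite Lmul_omega scalerA mulrC divfK.
by rewrite (LmulK e_basis char_neq2) // scaler_eq0 negb_or nzy Lexp_omega_neq0.
Qed.

Lemma Disc_coords m : Disc e m = invD (coords e m) *: Lexp om 2.
Proof. by []. Qed.

Lemma Disc_neq0 m : (Disc e m != 0) = (invD (coords e m) != 0).
Proof.
by rewrite Disc_coords scaler_eq0 (negPf (Lexp_omega_neq0 e_basis _)) // orbF.
Qed.

Lemma nu_coords m : invD (coords e m) != 0 ->
  nu e m = (- 8%:R * invP (coords e m) / invD (coords e m),
            invH (coords e m) / invD (coords e m)).
Proof.
move=> nzD; rewrite /nu /p3 /p2 /tp3 /tp2 Disc_coords cubic_tau hessian_tau.
by rewrite !(@Ldiv_omega 0 2) //; congr (_, _); rewrite /= /GRing.scale /= mulr1.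
Qed.

Definition nu_of (i : F * F * F * F) : F * F := let: (D, P, H, G) := i in
  (- 8%:R * P / D, H / D).

(** Clearing denominators on the left gives 1728 P^2 D + 4 H^3, since
    1728 = 27 * 8^2, and 1728 = 4 * 432 makes this four times the part of the
    syzygy that equals - G^2. *)
Lemma nu_of_syzygy i : on_syzygy i -> let: (D, P, H, G) := i in
  D ^+ 3 * (27%:R * (nu_of i).1 ^+ 2 + 4%:R * (nu_of i).2 ^+ 3) = - 4%:R * G ^+ 2.
Proof.
case: i => [[[D P] H] G] [nzD syz] /=.
transitivity (- 4%:R * G ^+ 2 + 4%:R * (G ^+ 2 + H ^+ 3 + 432%:R * P ^+ 2 * D)).
  by field.
by rewrite syz mulr0 addr0.
Qed.

Lemma cardano_nu_of D P H G : on_syzygy (D, P, H, G) ->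
  cardano (nu_of (D, P, H, G)) = (G == 0).
Proof.
move=> Vi; have := nu_of_syzygy Vi; move: Vi => [nzD _]; rewrite /cardano => E.
have nzD3 : D ^+ 3 != 0 by rewrite expf_neq0.
by rewrite -(inj_eq (mulfI nzD3)) E mulr0 mulf_eq0 oppr_eq0 (negPf nz4) sqrf_eq0.
Qed.

Lemma nu_of_inj D P H G P' H' G' : D != 0 ->
  nu_of (D, P, H, G) = nu_of (D, P', H', G') -> P = P' /\ H = H'.
Proof.
move=> nzD [/(mulIf (invr_neq0 nzD)) + /(mulIf (invr_neq0 nzD))].
by move/mulfI => -> //; rewrite oppr_eq0.
Qed.

Lemma on_syzygy_of_nu D G p3 p2 : D != 0 ->
    D ^+ 3 * (27%:R * p3 ^+ 2 + 4%:R * p2 ^+ 3) = - 4%:R * G ^+ 2 ->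
  let i := (D, - (p3 * D / 8%:R), p2 * D, G) in on_syzygy i /\ nu_of i = (p3, p2).
Proof.
move=> nzD E i; split; last by congr (_, _); field; rewrite ?nzD ?nz8.
split=> //.
apply: (mulfI nz4); rewrite mulr0.
transitivity (D ^+ 3 * (27%:R * p3 ^+ 2 + 4%:R * p2 ^+ 3) - - 4%:R * G ^+ 2).
  by field; rewrite ?nzD ?nz8.
by rewrite E subrr.
Qed.

Lemma scale_Lexp_inj r (k l : F) : k *: Lexp om r = l *: Lexp om r -> k = l.
Proof.
move/eqP; rewrite -subr_eq0 -scalerBl scaler_eq0.
by rewrite (negPf (Lexp_omega_neq0 e_basis _)) orbF subr_eq0 => /eqP.
Qed.

Lemma scale_Lexp_eq0 r (k : F) : (k *: Lexp om r == 0) = (k == 0).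
Proof. by rewrite scaler_eq0 (negPf (Lexp_omega_neq0 e_basis _)) orbF. Qed.

(** Off the Cardano curve the syzygy can be solved for D in terms of nu and
    g = G / D, because G^2 = g^2 D^2 has one factor D less than D^3. *)
Lemma SLbijection_generic : SLbijection (Ac3g e)
        (fun y : (F * F) * Lpow V 1 => ~~ cardano y.1 && (y.2 != 0))
        (fun m => (nu e m, Ldiv 1 2 (Inv e m) (Disc e m))).
Proof.
pose Dx i := ~~ cardano (nu_of i).
pose fx (i : F * F * F * F) :=
  (nu_of i, (54%:R^-1 * i.2 / i.1.1.1) *: Lexp om 1 : Lpow V 1).
apply: (SLbijection_of_invariants (Dx := Dx) (fx := fx)).
- move=> m; rewrite /Ac3g /Ac3 Disc_neq0 -andbA; congr (_ && _).
  by case nzD: (_ != 0) => //=; rewrite nu_coords.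
- move=> m /andP[/andP[_]]; rewrite Disc_neq0 => nzD _.
  by rewrite nu_coords // /Inv covariantG_tau Disc_coords (@Ldiv_omega 1 2).
- move=> [[[D P] H] G] Vi Dxi; apply/andP; split; first exact: Dxi.
  rewrite scale_Lexp_eq0.
  move: Dxi; rewrite /Dx cardano_nu_of // => nzG; case: (Vi) => nzD _.
  by rewrite !mulf_neq0 ?invr_neq0.
- move=> [[[D P] H] G] [[[D' P'] H'] G'] Vi Vj Dxi _ Ef.
  have [Ep3 Ep2] := congr1 fst Ef; have /scale_Lexp_inj Eg := congr1 snd Ef.
  have [nzD _] := Vi; have [nzD' _] := Vj.
  have {}Eg : G / D = G' / D'.
    by move: Eg; rewrite -!mulrA => /mulfI -> //; exact: invr_neq0.
  have ED : D = D'.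
    move: Dxi; rewrite /Dx /cardano /= => nzK; apply: (mulIf nzK).
    transitivity (- 4%:R * (G / D) ^+ 2).
      transitivity (- 4%:R * G ^+ 2 / D ^+ 2); last by field.
      by rewrite -(nu_of_syzygy Vi) /=; field.
    rewrite Eg Ep3 Ep2; transitivity (- 4%:R * G' ^+ 2 / D' ^+ 2); first by field.
    by rewrite -(nu_of_syzygy Vj) /=; field.
  subst D'; have [-> ->] : P = P' /\ H = H'.
    by apply: (@nu_of_inj D _ _ G _ _ G') => //=; rewrite Ep3 Ep2.
  by rewrite (divIf nzD Eg).
- move=> [[q3 q2] l] /andP[nzK]; rewrite [_.2]/=.
  have [k ->] := Lpow_omega e_basis char_neq2 l.
  rewrite scale_Lexp_eq0 => nzk; move: nzK; rewrite /cardano /=; set K := _ + _ => nzK.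
  pose g := 54%:R * k; pose D := - 4%:R * g ^+ 2 / K; pose G := g * D.
  have nzg : g != 0 by rewrite mulf_neq0.
  have nzD : D != 0 by rewrite !mulf_neq0 ?oppr_eq0 ?invr_eq0.
  have [] := @on_syzygy_of_nu D G q3 q2 nzD.
    rewrite -/K /G; transitivity (D ^+ 2 * (D * K)); first by ring.
    by rewrite [D * K]divfK //; ring.
  move=> Vi Enu; eexists; split; first exact: Vi.
    by rewrite /Dx Enu.
  by rewrite /fx Enu /= /G mulrA mulfK // mulKf.
Qed.

(** On the Cardano curve G = 0, so nu and D recover P and H and nothing else is
    left; conversely the syzygy with G = 0 is the equation of the curve. *)
Lemma SLbijection_cardano : SLbijection (Ac3C e)
        (fun y : (F * F) * Lpow V 2 =>
           [&& cardano y.1, y.1 != (0, 0) & y.2 != 0])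
        (fun m => (nu e m, Disc e m)).
Proof.
pose Dx i := cardano (nu_of i) && (nu_of i != (0, 0)).
pose fx (i : F * F * F * F) := (nu_of i, i.1.1.1 *: Lexp om 2 : Lpow V 2).
apply: (SLbijection_of_invariants (Dx := Dx) (fx := fx)).
- move=> m; rewrite /Ac3C /Ac3 Disc_neq0 -andbA; congr (_ && _).
  by case nzD: (_ != 0) => //=; rewrite nu_coords.
- by move=> m /andP[/andP[_]]; rewrite Disc_neq0 => nzD _; rewrite nu_coords.
- move=> [[[D P] H] G] [nzD _] /andP[cD nz].
  by apply/and3P; split; [exact: cD | exact: nz | rewrite scale_Lexp_eq0].
- move=> [[[D P] H] G] [[[D' P'] H'] G'] Vi Vj /andP[+ _] /andP[+ _].
  rewrite !cardano_nu_of // => /eqP-> /eqP-> Ef.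
  have [Ep3 Ep2] := congr1 fst Ef; have /scale_Lexp_inj /= ED := congr1 snd Ef.
  subst D'; have [nzD _] := Vi; have [-> ->] // : P = P' /\ H = H'.
  by apply: (@nu_of_inj D _ _ 0 _ _ 0) => //=; rewrite Ep3 Ep2.
- move=> [[q3 q2] l] /and3P[c0 nz]; rewrite [_.2]/=.
  have [D ->] := Lpow_omega e_basis char_neq2 l.
  rewrite scale_Lexp_eq0 => nzD; have [] := @on_syzygy_of_nu D 0 q3 q2 nzD.
    by move: c0; rewrite /cardano /= => /eqP->; rewrite expr0n !mulr0.
  move=> Vi Enu; eexists; split; first exact: Vi.
    by rewrite /Dx Enu c0.
  by rewrite /fx Enu.
Qed.

Lemma SLbijection_origin : SLbijection (Ac30 e)
        (fun y : Lpow V 2 => y != 0)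
        (fun m => Disc e m).
Proof.
pose Dx i := nu_of i == (0, 0).
pose fx (i : F * F * F * F) := (i.1.1.1 *: Lexp om 2 : Lpow V 2).
have c0 : cardano (0, 0 : F) by rewrite /cardano /= !expr0n /= !mulr0 addr0.
apply: (SLbijection_of_invariants (Dx := Dx) (fx := fx)).
- move=> m; rewrite /Ac30 /Ac3 Disc_neq0 -andbA; congr (_ && _).
  by case nzD: (_ != 0) => //=; rewrite nu_coords.
- by [].
- by move=> [[[D P] H] G] [nzD _] _; rewrite scale_Lexp_eq0.
- move=> [[[D P] H] G] [[[D' P'] H'] G'] Vi Vj /eqP Ei /eqP Ej.
  move=> /scale_Lexp_inj /= ED.
  subst D'; have [nzD _] := Vi; have [-> ->] : P = P' /\ H = H'.
    by apply: (@nu_of_inj D _ _ G _ _ G') => //; rewrite Ei.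
  have := cardano_nu_of Vi; have := cardano_nu_of Vj; rewrite Ei Ej c0.
  by move=> /esym/eqP-> /esym/eqP->.
- move=> l; have [D ->] := Lpow_omega e_basis char_neq2 l.
  rewrite scale_Lexp_eq0 => nzD; have [] := @on_syzygy_of_nu D 0 0 0 nzD.
    by move: c0; rewrite /cardano /= => /eqP->; rewrite expr0n !mulr0.
  move=> Vi Enu; eexists; split; first exact: Vi.
    by rewrite /Dx Enu.
  by [].
Qed.

End Classification.

Theorem theorem1p4 (F : closedFieldType)
    (char_neq2 : 2%N \notin [pchar F]) (char_neq3 : 3%N \notin [pchar F])
    (V : vectType F) (dimV : \dim {:V} = 2%N)
    (e : 2.-tuple V) (e_basis : basis_of {:V} e) :
  [/\ SLbijection (Ac3g e)
        (fun y : (F * F) * Lpow V 1 => ~~ cardano y.1 && (y.2 != 0))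
        (fun m => (nu e m, Ldiv 1 2 (Inv e m) (Disc e m))),
      SLbijection (Ac3C e)
        (fun y : (F * F) * Lpow V 2 =>
           [&& cardano y.1, y.1 != (0, 0) & y.2 != 0])
        (fun m => (nu e m, Disc e m))
    & SLbijection (Ac30 e)
        (fun y : Lpow V 2 => y != 0)
        (fun m => Disc e m)].
Proof.
by split; [apply: SLbijection_generic | apply: SLbijection_cardano
          | apply: SLbijection_origin].
Qed.
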